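(* Let $d,n\ge1$, $k\ge0$, and let $\Sigma\in\mathbb{R}^{d\times d}$ be positive definite. Let $x^{(1)},\dots,x^{(n+1)}$ be i.i.d. $\mathcal{N}(0,\Sigma)$, $w_\star\sim\mathcal{N}(0,\Sigma^{-1})$ independent, and $y^{(i)}=\langle x^{(i)},w_\star\rangle$ for $i\le n$. Let $$Z_0=\begin{bmatrix} x^{(1)} & \cdots & x^{(n)} & x^{(n+1)}\\ y^{(1)} & \cdots & y^{(n)} & 0\end{bmatrix},\qquad M=\begin{bmatrix} I_n & 0\\ 0& 0\end{bmatrix}\in\mathbb{R}^{(n+1)\times(n+1)}.$$ For $A=\{A_i\}_{i=0}^k$, $B=\{B_i\}_{i=0}^k$ with $A_i,B_i\in\mathbb{R}^{d\times d}$ and each $A_i$ symmetric, set $P_i=\begin{bmatrix}B_i&0\\0&1\end{bmatrix}$, $Q_i=\begin{bmatrix}A_i&0\\0&0\end{bmatrix}$, $Z_{i+1}=Z_i+\frac1nP_iZ_iM(Z_i^\top Q_iZ_i)$ for $i=0,\dots,k$, and $$f(A,B)=\mathbb{E}\Big[\big([Z_{k+1}]_{d+1,n+1}+w_\star^\top x^{(n+1)}\big)^2\Big].$$ Let $\mathcal{S}$ be the set of pairs $(A,B)$ such that for every $i\in\{0,\dots,k\}$ there are scalars $a_i,b_i\in\mathbb{R}$ with $A_i=a_i\Sigma^{-1}$ and $B_i=b_iI_d$. Then $$\inf_{(A,B)\in\mathcal{S}}\sum_{i=0}^k\Big(\|\nabla_{A_i}f(A,B)\|_F^2+\|\nabla_{B_i}f(A,B)\|_F^2\Big)=0,$$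 where $\nabla_{A_i}f$, $\nabla_{B_i}f$ denote gradients with respect to the matrices $A_i$, $B_i$ (Frobenius inner product).
   Context: $[X]_{i,j}$ denotes the $(i,j)$ entry of a matrix; $\|\cdot\|_F$ is the Frobenius norm. The expectation is over $x^{(1)},\dots,x^{(n+1)},w_\star$. *)

(* Defs.v *)
From HB Require Import structures.
From mathcomp Require Import all_boot all_order all_algebra.
From mathcomp Require Import all_classical all_reals all_analysis.
Set Implicit Arguments. Unset Strict Implicit. Unset Printing Implicit Defensive.
Import Order.TTheory GRing.Theory Num.Theory.
Local Open Scope classical_set_scope.
Local Open Scope ring_scope.

(* Mutual independence of a finite family of real random variables:
   product rule for every choice of Borel sets (taking B i = setT recovers
   every subfamily). *)
Definition mutually_independent {dT} {T : measurableType dT} {R : realType}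
  (P : probability T R) {I : finType} (g : I -> T -> R) : Prop :=
  forall B : I -> set R, (forall i, measurable (B i)) ->
    P (\bigcap_(i in [set: I]) (g i @^-1` B i)) =
    (\prod_(i : I) P (g i @^-1` B i))%E.

Definition std_normal_rv {dT} {T : measurableType dT} {R : realType}
  (P : probability T R) (X : T -> R) : Prop :=
  measurable_fun setT X /\
  forall B : set R, measurable B -> P (X @^-1` B) = normal_prob 0 1 B.

Definition iid_std_normal {dT} {T : measurableType dT} {R : realType}
  (P : probability T R) {I : finType} (g : I -> T -> R) : Prop :=
  (forall i, std_normal_rv P (g i)) /\ mutually_independent P g.

Definition posdef {R : realType} {d : nat} (S : 'M[R]_d) : Prop :=
  S^T = S /\ forall v : 'cV[R]_d, v != 0 -> 0 < (v^T *m S *m v) 0 0.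

Section LT.
Variables (R : realType) (d n k : nat).

Definition Z0 (X : 'M[R]_(d, n + 1)) (w : 'cV[R]_d) : 'M[R]_(d + 1, n + 1) :=
  col_mx X (row_mx (\row_(j < n) \sum_(l < d) X l (lshift 1 j) * w l 0)
                   (0 : 'M[R]_(1, 1))).

Definition Mmask : 'M[R]_(n + 1) := block_mx 1%:M 0 0 0.

Definition Pmat (Bi : 'M[R]_d) : 'M[R]_(d + 1) := block_mx Bi 0 0 1%:M.
Definition Qmat (Ai : 'M[R]_d) : 'M[R]_(d + 1) := block_mx Ai 0 0 0.

Definition lt_step (Ai Bi : 'M[R]_d) (Z : 'M[R]_(d + 1, n + 1)) :
  'M[R]_(d + 1, n + 1) :=
  Z + (n%:R)^-1 *: (Pmat Bi *m Z *m Mmask *m (Z^T *m Qmat Ai *m Z)).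

Fixpoint Zit (A B : 'I_k.+1 -> 'M[R]_d) (X : 'M[R]_(d, n + 1)) (w : 'cV[R]_d)
  (m : nat) : 'M[R]_(d + 1, n + 1) :=
  match m with
  | 0 => Z0 X w
  | m'.+1 => lt_step (A (inord m')) (B (inord m')) (Zit A B X w m')
  end.

Definition lt_pred (A B : 'I_k.+1 -> 'M[R]_d) (X : 'M[R]_(d, n + 1))
  (w : 'cV[R]_d) : R :=
  Zit A B X w k.+1 (rshift d (ord0 : 'I_1)) (rshift n (ord0 : 'I_1)).

End LT.

Definition lt_loss {dT} {T : measurableType dT} {R : realType}
  (P : probability T R) (d n k : nat)
  (X : T -> 'M[R]_(d, n + 1)) (w : T -> 'cV[R]_d)
  (A B : 'I_k.+1 -> 'M[R]_d) : R :=
  fine ('E_P[fun t => (lt_pred A B (X t) (w t)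
           + \sum_(l < d) w t l 0 * X t l (rshift n (ord0 : 'I_1))) ^+ 2]%R)%E.

Definition upd {R : realType} {d k : nat} (A : 'I_k.+1 -> 'M[R]_d)
  (i : 'I_k.+1) (M : 'M[R]_d) : 'I_k.+1 -> 'M[R]_d :=
  fun i' => if i' == i then M else A i'.

Definition gradA {R : realType} {d k : nat}
  (f : ('I_k.+1 -> 'M[R]_d) -> ('I_k.+1 -> 'M[R]_d) -> R)
  (A B : 'I_k.+1 -> 'M[R]_d) (i : 'I_k.+1) : 'M[R]_d :=
  \matrix_(j, l) derive1 (fun t : R => f (upd A i (A i + t *: delta_mx j l)) B) 0.

Definition gradB {R : realType} {d k : nat}
  (f : ('I_k.+1 -> 'M[R]_d) -> ('I_k.+1 -> 'M[R]_d) -> R)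
  (A B : 'I_k.+1 -> 'M[R]_d) (i : 'I_k.+1) : 'M[R]_d :=
  \matrix_(j, l) derive1 (fun t : R => f A (upd B i (B i + t *: delta_mx j l))) 0.

Definition frob2 {R : realType} {d : nat} (M : 'M[R]_d) : R :=
  \sum_(j < d) \sum_(l < d) M j l ^+ 2.

(* Main.v *)
Require Import Defs.
From HB Require Import structures.
From mathcomp Require Import all_boot all_order all_algebra.
From mathcomp Require Import all_classical all_reals all_analysis.
From mathcomp Require Import perm measurable_realfun ring lra.
Set Implicit Arguments. Unset Strict Implicit. Unset Printing Implicit Defensive.
Import Order.TTheory GRing.Theory Num.Theory.
Import numFieldNormedType.Exports.
Local Open Scope classical_set_scope.
Local Open Scope ring_scope.

(** The loss is a polynomial in the entries of the [A_i], [B_i], since the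
    prediction is polynomial in the data and Gaussians have all moments.
    In whitened coordinates it is invariant under simultaneous conjugation of
    all [A_i], [B_i] by signed permutation matrices, because these preserve
    the law of the Gaussian inputs; [w_star] only enters through its second
    moment. At a point of S, whose whitened matrices are scalar, the
    differential in each block is therefore invariant under that conjugation,
    hence proportional to the trace: the whole gradient is controlled by the
    gradient of the restriction of the loss to S, a nonnegative polynomial on
    a finite-dimensional space. Such a polynomial [h] has almost critical
    points: a minimizer [x] of [h + e |x|^2] satisfies [grad h (x) = - 2 e x]
    and [e |x|^2 <= h 0]. *)

(** * Polynomial functions *)

(** A closure predicate in place of formal polynomials: differentiability along lines, continuity,
    measurability and finiteness of moments each follow by induction on the four constructors. *)
Inductive polyfn (R : realType) (I : Type) : ((I -> R) -> R) -> Prop :=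
| polyfn_cst c : polyfn (fun=> c)
| polyfn_var i : polyfn (fun x => x i)
| polyfnD f g : polyfn f -> polyfn g -> polyfn (fun x => f x + g x)
| polyfnM f g : polyfn f -> polyfn g -> polyfn (fun x => f x * g x).

Section PolynomialFunctions.
Context {R : realType}.

Lemma polyfn_sum (I : Type) (J : finType) (F : J -> (I -> R) -> R) :
  (forall j, polyfn (F j)) -> polyfn (fun x => \sum_j F j x).
Proof.
move=> hF.
suff H (s : seq J) : polyfn (fun x => \sum_(j <- s) F j x) by exact: H.
elim: s => [|j s IH].
  rewrite (_ : (fun x => _) = (fun=> 0)); first exact: polyfn_cst.
  by apply/funext => x; rewrite big_nil.
rewrite (_ : (fun x => _) = (fun x => F j x + \sum_(j <- s) F j x)).
  exact: polyfnD.
by apply/funext => x; rewrite big_cons.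
Qed.

Lemma polyfn_subst (I J : Type) (f : (I -> R) -> R) (s : (J -> R) -> I -> R) :
  polyfn f -> (forall i, polyfn (fun x => s x i)) -> polyfn (fun x => f (s x)).
Proof.
move=> hf hs; elim: hf => [c|i|f1 f2 _ h1 _ h2|f1 f2 _ h1 _ h2].
- exact: polyfn_cst.
- exact: hs.
- exact: (polyfnD h1 h2).
- exact: (polyfnM h1 h2).
Qed.

Definition partial (I : eqType) (i : I) (f : (I -> R) -> R) (x : I -> R) : R :=
  derive1 (fun t : R => f (fun j => x j + t * (j == i)%:R)) 0.

(** The derivative along a line is linear in the direction. The induction yields one vector [D] that
    serves all directions at once; testing it on coordinate directions then identifies [D i] with
    [partial i f x]. *)
Lemma polyfn_line (I : finType) (f : (I -> R) -> R) (x v : I -> R) : polyfn f ->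
  is_derive (0 : R) 1 (fun t : R => f (fun j => x j + t * v j))
    (\sum_i v i * partial i f x).
Proof.
move=> hf.
have [D hD] : exists D : I -> R, forall v,
    is_derive (0 : R) 1 (fun t : R => f (fun j => x j + t * v j)) (\sum_i v i * D i).
  elim: hf => {f} [c|i|f1 f2 _ [D1 h1] _ [D2 h2]|f1 f2 _ [D1 h1] _ [D2 h2]].
  - exists (fun=> 0) => u; rewrite big1 => [|i _]; last by rewrite mulr0.
    exact: is_derive_cst.
  - exists (fun j => (j == i)%:R) => u.
    rewrite (bigD1 i)//= eqxx mulr1 big1 ?addr0; last first.
      by move=> j /negbTE->; rewrite mulr0.
    apply: is_derive_eq; rewrite /GRing.scale/=; ring.
  - exists (fun i => D1 i + D2 i) => u; have := h1 u; have := h2 u => ? ?.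
    by apply: is_derive_eq; rewrite -big_split; apply: eq_bigr => i _; rewrite mulrDr.
  - exists (fun i => f1 x * D2 i + f2 x * D1 i) => u; have := h1 u; have := h2 u => ? ?.
    apply: is_derive_eq; rewrite /GRing.scale/=.
    have -> : (fun j => x j + 0 * u j) = x by apply/funext => j; rewrite mul0r addr0.
    rewrite !mulr_sumr -big_split; apply: eq_bigr => i _ /=; ring.
suff -> : \sum_i v i * partial i f x = \sum_i v i * D i by exact: hD.
apply: eq_bigr => i _; congr (_ * _).
have := hD (fun j => (j == i)%:R) => /@derive_val; rewrite -derive1E /partial => ->.
rewrite (bigD1 i)//= eqxx mul1r big1 ?addr0// => j /negbTE->.
by rewrite mul0r.
Qed.

Lemma polyfn_derivable_line (I : Type) (f : (I -> R) -> R) (x v : I -> R) (t : R) :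
  polyfn f -> derivable (fun t : R => f (fun j => x j + t * v j)) t 1.
Proof.
elim => [c|i|f1 f2 _ h1 _ h2|f1 f2 _ h1 _ h2].
- exact: derivable_cst.
- apply: derivableD; first exact: derivable_cst.
  by apply: derivableM; [exact: derivable_id|exact: derivable_cst].
- exact: (derivableD h1 h2).
- exact: (derivableM h1 h2).
Qed.

Lemma polyfn_continuous_rV n (f : ('I_n -> R) -> R) : polyfn f ->
  continuous (fun v : 'rV[R]_n => f (fun i => v ord0 i)).
Proof.
elim => [c|i|f1 f2 _ h1 _ h2|f1 f2 _ h1 _ h2] v.
- exact: cst_continuous.
- exact: coord_continuous.
- exact: (@continuousD _ _ _ (fun v : 'rV[R]_n => f1 (fun i => v ord0 i)) _ _ (h1 v) (h2 v)).
- exact: (@continuousM _ _ (fun v : 'rV[R]_n => f1 (fun i => v ord0 i)) _ _ (h1 v) (h2 v)).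
Qed.

(** The penalized function [q] attains its minimum on a cube so large that outside it the penalty
    alone is at least [f 0], so the minimizer [y] is global. There the squared gradient of [f] is
    [4 e (e |y|^2) <= 4 e f 0]. *)
Lemma polyfn_almost_critical_ord n (f : ('I_n -> R) -> R) : polyfn f ->
  (forall x, 0 <= f x) -> forall eps, 0 < eps ->
  exists x, \sum_i partial i f x ^+ 2 <= eps.
Proof.
move=> pf f0 eps eps0.
have F0 := f0 (fun=> 0); set F := f (fun=> 0) in F0.
(* Chosen so that [4 e F <= eps]; [F + 1] keeps the denominator positive when [F = 0]. *)
pose e := eps / (4 * (F + 1)).
have e0 : 0 < e by rewrite divr_gt0// mulr_gt0// ltr_wpDl.
have epsE : eps = 4 * e * (F + 1).
  by rewrite /e mulrAC mulrCA divff ?mulr1// gt_eqF// mulr_gt0// ltr_wpDl.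
have e4 : 0 < 4 * e by rewrite mulr_gt0.
move: e e0 epsE e4 => e e0 epsE e4.
pose q x := f x + e * \sum_i x i ^+ 2.
have pq : polyfn q.
  apply: polyfnD => //; apply: polyfnM; first exact: polyfn_cst.
  apply: polyfn_sum => i; rewrite (_ : (fun x => _) = (fun x => x i * x i)).
    by apply: polyfnM; exact: polyfn_var.
  by apply/funext => x; rewrite expr2.
(* The half-width of the cube: [e M >= F] makes the penalty dominate, and [M >= 1] turns [|z i| > M]
   into [z i ^+ 2 >= M]. *)
pose M := F / e + 1.
have M1 : 1 <= M by rewrite lerDr divr_ge0// ltW.
pose A := [set v : 'rV[R]_n | forall i, `[- M, M]%classic (v ord0 i)].
have cA : compact A.
  by apply: (@rV_compact _ _ (fun=> `[- M, M]%classic)) => i; exact: segment_compact.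
have A0 : A 0.
  by move=> i; rewrite /= mxE in_itv/= oppr_le0 andbb (le_trans _ M1).
have [||c cinA cmin] := @EVT_min_rV R n (fun v => q (fun i => v ord0 i)) A _ cA.
- by exists 0.
- by apply: continuous_subspaceT; exact: polyfn_continuous_rV.
have q0 : q (fun=> 0) = F.
  by rewrite /q big1 ?mulr0 ?addr0// => i _; rewrite expr0n.
pose y i := c ord0 i.
have yq0 : q y <= F.
  rewrite -q0; have := cmin 0 (mem_set A0); congr (_ <= q _).
  by apply/funext => i; rewrite mxE.
have ymin z : q y <= q z.
  have [zA|/existsNP[i zi]] := pselect (forall i, `[- M, M]%classic (z i)).
    have zE : (fun i => (\row_i z i : 'rV[R]_n) ord0 i) = z.
      by apply/funext => i; rewrite mxE.
    rewrite -zE; apply: cmin; rewrite inE => i.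
    by rewrite mxE; exact: zA.
  apply: (le_trans yq0).
  have M2 : M < `|z i|.
    by rewrite ltNge; apply/negP => h; apply: zi; rewrite /= in_itv/= -ler_norml.
  have zM : M <= \sum_i z i ^+ 2.
    rewrite (bigD1 i)//= -[leLHS]addr0 lerD//; last first.
      by rewrite sumr_ge0// => j _; rewrite sqr_ge0.
    by rewrite -real_normK ?num_real//; nra.
  have : F <= e * M.
    by rewrite /M mulrDr mulr1 mulrCA divff ?gt_eqF// mulr1 lerDl ltW.
  move=> /le_trans; apply; rewrite /q.
  by rewrite -[leLHS]add0r lerD// ler_pM2l.
have pfy i : partial i f y = - (2 * e * y i).
  pose u j : R := (j == i)%:R.
  have sumu (G : 'I_n -> R) : \sum_j u j * G j = G i.
    rewrite (bigD1 i)//= /u eqxx mul1r big1 ?addr0// => j /negbTE->.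
    by rewrite mul0r.
  have hf := polyfn_line y u pf; rewrite sumu in hf.
  (* The derivative of [q] along coordinate [i] is found twice: it vanishes by minimality, on an
     arbitrary interval around 0, and expanding the penalty gives [partial i f y + 2 e y i]. *)
  have hq0 : is_derive (0 : R) 1 (fun t : R => q (fun j => y j + t * u j)) 0.
    apply: (@derive1_at_min _ _ (-1) 1); rewrite ?in_itv/=.
    - by lra.
    - by move=> t _; exact: polyfn_derivable_line.
    - by lra.
    - move=> t _; rewrite (_ : (fun j => y j + 0 * _) = y)//.
      by apply/funext => j; rewrite mul0r addr0.
  have qE : (fun t : R => q (fun j => y j + t * u j)) =
      (fun t : R => f (fun j => y j + t * u j) +
         (e * (\sum_j y j ^+ 2) + (2 * e * y i * t + e * (t * t)))).
    apply/funext => t; rewrite /q; congr (_ + _).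
    rewrite (eq_bigr (fun j => y j ^+ 2 + u j * (2 * t * y j + t * t))); last first.
      by move=> j _; rewrite /u; case: (j == i); rewrite /=; ring.
    by rewrite big_split /= sumu; ring.
  have hq : is_derive (0 : R) 1 (fun t : R => q (fun j => y j + t * u j))
      (partial i f y + 2 * e * y i).
    by rewrite qE; apply: is_derive_eq; rewrite /GRing.scale/=; ring.
  have := @derive_val _ _ _ _ _ _ _ hq; rewrite (@derive_val _ _ _ _ _ _ _ hq0).
  by move=> /esym/eqP; rewrite addr_eq0 => /eqP.
exists y; under eq_bigr do rewrite pfy.
rewrite (eq_bigr (fun i => 4 * e * (e * y i ^+ 2))); last by move=> i _; ring.
rewrite -mulr_sumr -mulr_sumr.
apply: (@le_trans _ _ (4 * e * F)).
  by rewrite ler_pM2l//; apply: (le_trans _ yq0); rewrite /q lerDr f0.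
by rewrite epsE ler_pM2l// lerDl.
Qed.

(** The compactness argument lives on row vectors; [enum_rank] transports it to any finite index
    type. *)
Lemma polyfn_almost_critical (J : finType) (f : (J -> R) -> R) : polyfn f ->
  (forall x, 0 <= f x) -> forall eps, 0 < eps ->
  exists x, \sum_i partial i f x ^+ 2 <= eps.
Proof.
move=> pf f0 eps eps0.
pose h (z : 'I_#|J| -> R) := f (fun j => z (enum_rank j)).
have ph : polyfn h by apply: (polyfn_subst pf) => j; exact: polyfn_var.
have [z hz] := polyfn_almost_critical_ord ph (fun z => f0 _) eps0.
exists (fun j => z (enum_rank j)); move: hz.
rewrite (reindex_onto enum_rank enum_val) => [|i _]; last exact: enum_valK.
rewrite (eq_bigl xpredT) => [|i]; last by rewrite enum_rankK eqxx.
congr (_ <= _); apply: eq_bigr => j _.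
apply: (congr1 (fun u : R -> R => derive1 u 0 ^+ 2)); rewrite /h.
by apply/funext => t; congr f; apply/funext => i; rewrite (inj_eq enum_rank_inj).
Qed.

End PolynomialFunctions.

(** * Gaussian moments *)

Section NormalLaw.
Context {R : realType}.
Local Notation mu := (@lebesgue_measure R).
Local Notation N01 := (normal_prob (0 : R) 1).

(** The Radon-Nikodym derivative agrees almost everywhere with the explicit density, because both
    integrate to the measure of every measurable set. *)
Lemma ge0_integral_normal_prob (f : R -> \bar R) :
  measurable_fun setT f -> (forall x, 0 <= f x)%E ->
  (\int[N01]_x f x = \int[mu]_x (f x * (normal_pdf 0 1 x)%:E))%E.
Proof.
move=> mf f0.
have dom := normal_prob_dominates (0 : R) 1.
rewrite -(Radon_Nikodym_SigmaFinite.change_of_variables dom)//.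
have iRN := Radon_Nikodym_SigmaFinite.f_integrable dom.
apply: ae_eq_integral => //.
- by apply: emeasurable_funM => //; exact: (measurable_int mu).
- apply: emeasurable_funM => //; apply/measurable_EFinP.
  exact: measurable_normal_pdf.
- apply: ae_eqe_mul2l; apply: integral_ae_eq => //.
    by apply/measurable_EFinP; exact: measurable_normal_pdf.
  by move=> E _ mE; rewrite -(Radon_Nikodym_SigmaFinite.f_integral dom).
Qed.

(** Completing the square: exponential tilting shifts the mean, which gives the exponential
    moments. *)
Lemma normal_pdf_tilt (c x : R) :
  expR (c * x) * normal_pdf 0 1 x = expR (c ^+ 2 / 2) * normal_pdf c 1 x.
Proof.
rewrite !normal_pdfE ?oner_eq0// mulrCA [RHS]mulrCA /normal_fun -!expRD.
by congr (_ * expR _); rewrite expr1n; field.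
Qed.

(** One term of the exponential series at [|x|] bounds the power, and [exp |x|] is one of the two
    summands on the right. *)
Lemma normX_le_expR (m : nat) (x : R) : `|x| ^+ m <= m`!%:R * (expR x + expR (- x)).
Proof.
have E0 : expR `|x| <= expR x + expR (- x).
  by have [x0|x0] := ger0P x; rewrite ?lerDl ?lerDr expR_ge0.
apply: le_trans (ler_wpM2l _ E0) => //.
case: m => [|m].
  by rewrite expr0 fact0 mul1r; apply: le_trans (expR_ge1Dx _); rewrite lerDl.
rewrite -ler_pdivrMl ?ltr0n ?fact_gt0// mulrC.
by apply: le_trans (expR_ge1Dxn m (normr_ge0 x)); rewrite lerDr.
Qed.

(** After domination by [exp x + exp (- x)], tilting leaves constant multiples of the Gaussian
    densities with means [1] and [-1], each of total mass one. *)
Lemma normal_prob_absmoment (m : nat) : (\int[N01]_x (`|x| ^+ m)%:E < +oo)%E.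
Proof.
have mpdf c : measurable_fun setT (fun x => (expR (c ^+ 2 / 2) * normal_pdf c (1 : R) x)%:E).
  apply/measurable_EFinP; apply: measurable_funM => //.
  exact: measurable_normal_pdf.
have mX : measurable_fun [set: R] (fun x => `|x| ^+ m).
  by apply: measurable_funX; exact: normr_measurable.
rewrite ge0_integral_normal_prob; last 2 first.
- exact/measurable_EFinP.
- by move=> x; rewrite lee_fin exprn_ge0.
pose h c x := expR (c ^+ 2 / 2) * normal_pdf c (1 : R) x.
have h0 c x : 0 <= h c x by rewrite mulr_ge0 ?expR_ge0 ?normal_pdf_ge0.
apply: (@le_lt_trans _ _ (\int[mu]_x (m`!%:R%:E * ((h 1 x)%:E + (h (-1) x)%:E)))%E).
  apply: ge0_le_integral => //.
  - by move=> x _; rewrite mule_ge0// lee_fin ?exprn_ge0 ?normal_pdf_ge0.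
  - apply: emeasurable_funM; first exact/measurable_EFinP.
    by apply/measurable_EFinP; exact: measurable_normal_pdf.
  - by apply: measurable_funeM; apply: emeasurable_funD; exact: mpdf.
  - move=> x _; rewrite -EFinD -!EFinM lee_fin /h.
    rewrite -(normal_pdf_tilt 1 x) -(normal_pdf_tilt (-1) x).
    rewrite -mulrDl mulrA ler_wpM2r ?normal_pdf_ge0// mul1r mulN1r.
    exact: normX_le_expR.
rewrite ge0_integralZl//; last 2 first.
- by apply: emeasurable_funD; exact: mpdf.
- by move=> x _; rewrite -EFinD lee_fin addr_ge0.
rewrite ge0_integralD//; try by move=> x _; rewrite lee_fin; exact: h0.
2,3: exact: mpdf.
have hE c : (\int[mu]_x (h c x)%:E = (expR (c ^+ 2 / 2))%:E)%E.
  under eq_integral do rewrite EFinM.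
  rewrite ge0_integralZl//; last 2 first.
  - by apply/measurable_EFinP; exact: measurable_normal_pdf.
  - by move=> x _; rewrite lee_fin normal_pdf_ge0.
  - by rewrite integral_normal_pdf mule1.
by rewrite !hE -EFinD -EFinM ltry.
Qed.

(** The density is even, and Lebesgue measure equals its image under negation, as a comparison on
    half-open intervals shows. *)
Lemma normal_prob_opp (B : set R) : measurable B ->
  N01 ((fun x => - x) @^-1` B) = N01 B.
Proof.
move=> mB.
have mopp : measurable_fun [set: measurableTypeR R]
    (fun x : measurableTypeR R => - x : measurableTypeR R).
  exact: oppr_measurable.
pose nu : {measure set (measurableTypeR R) -> \bar R} :=
  measure_function_pushforward__canonical__measure_function_Measure mu mopp.
have nuE (A : set R) : measurable A -> mu A = nu A.
  apply: lebesgue_measure_unique => _ [[a b] _ <-] /=.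
  rewrite /pushforward (_ : _ @^-1` _ = `[- b, - a[%classic); last first.
    by apply/seteqP; split => x /=; rewrite !in_itv/= => /andP[? ?]; apply/andP; split; lra.
  rewrite !lebesgue_measure_itv/= !lte_fin ltrN2; case: ifP => // _.
  by rewrite -!EFinB; congr EFin; lra.
rewrite /normal_prob [RHS](eq_measure_integral nu); last by move=> A mA _; exact: nuE.
rewrite (ge0_integral_pushforward mopp)//.
- apply: eq_integral => x _ /=; congr EFin.
  by rewrite !normal_pdfE ?oner_eq0// /normal_fun !subr0 sqrrN.
- by apply: measurable_funTS; apply/measurable_EFinP; exact: measurable_normal_pdf.
- by move=> x _; rewrite lee_fin normal_pdf_ge0.
Qed.

End NormalLaw.

Section Moments.
Context {R : realType} {dT : measure_display} {T : measurableType dT} (P : probability T R).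
Local Notation N01 := (normal_prob (0 : R) 1).

(** Unlike bare integrability, finiteness of all absolute moments is stable under products, so it
    passes through an induction on [polyfn]. *)
Definition has_moments (Y : T -> R) :=
  measurable_fun setT Y /\ forall m : nat, (\int[P]_t (`|Y t| ^+ m)%:E < +oo)%E.

Lemma measurable_absX (Y : T -> R) (m : nat) : measurable_fun setT Y ->
  measurable_fun setT (fun t => (`|Y t| ^+ m)%:E).
Proof.
move=> mY; apply/measurable_EFinP; apply: measurable_funX.
exact: measurableT_comp mY.
Qed.

Lemma has_moments_std_normal (Y : T -> R) : std_normal_rv P Y -> has_moments Y.
Proof.
move=> [mY YN]; split=> // m.
have mY' : measurable_fun [set: T] (Y : T -> measurableTypeR R) by [].
pose nu : {measure set (measurableTypeR R) -> \bar R} :=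
  measure_function_pushforward__canonical__measure_function_Measure P mY'.
have := normal_prob_absmoment m (R := R).
rewrite (eq_measure_integral nu); last by move=> A mA _; rewrite /= /pushforward YN.
rewrite (ge0_integral_pushforward mY')//.
by apply/measurable_EFinP; apply: measurable_funX; exact: normr_measurable.
Qed.

Lemma has_moments_cst (c : R) : has_moments (fun=> c).
Proof.
split=> // m; rewrite integral_cst// lte_mul_pinfty ?lee_fin ?exprn_ge0//.
exact: le_lt_trans (probability_le1 P measurableT) (ltry 1).
Qed.

(** The sum is at most twice the larger of the two absolute values, whence the factor [2 ^+ m]. *)
Lemma has_momentsD (Y Z : T -> R) : has_moments Y -> has_moments Z ->
  has_moments (fun t => Y t + Z t).
Proof.
move=> [mY hY] [mZ hZ]; split; first exact: measurable_funD.
move=> m; apply: (@le_lt_trans _ _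
  (\int[P]_t ((2 ^+ m)%:E * ((`|Y t| ^+ m)%:E + (`|Z t| ^+ m)%:E)))%E).
  apply: ge0_le_integral => //.
  - exact: (measurable_absX m (measurable_funD mY mZ)).
  - by apply: measurable_funeM; apply: emeasurable_funD; exact: measurable_absX.
  - move=> t _; rewrite -EFinD -EFinM lee_fin.
    have [yz|/ltW zy] := leP `|Y t| `|Z t|.
    + apply: (@le_trans _ _ ((2 * `|Z t|) ^+ m)).
        by rewrite lerXn2r ?nnegrE//; have := ler_normD (Y t) (Z t); lra.
      by rewrite exprMn ler_wpM2l ?exprn_ge0// lerDr exprn_ge0.
    + apply: (@le_trans _ _ ((2 * `|Y t|) ^+ m)).
        by rewrite lerXn2r ?nnegrE//; have := ler_normD (Y t) (Z t); lra.
      by rewrite exprMn ler_wpM2l ?exprn_ge0// lerDl exprn_ge0.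
rewrite ge0_integralZl//; last 2 first.
- by apply: emeasurable_funD; exact: measurable_absX.
- by move=> t _; rewrite adde_ge0// lee_fin exprn_ge0.
rewrite ge0_integralD//; try exact: measurable_absX.
by rewrite lte_mul_pinfty ?lee_fin ?exprn_ge0// lte_add_pinfty.
Qed.

(** From [a b <= a^2 + b^2] with [a = |Y|^m] and [b = |Z|^m]: order [m] of the product consumes
    order [2m] of the factors. *)
Lemma has_momentsM (Y Z : T -> R) : has_moments Y -> has_moments Z ->
  has_moments (fun t => Y t * Z t).
Proof.
move=> [mY hY] [mZ hZ]; split; first exact: measurable_funM.
move=> m; apply: (@le_lt_trans _ _
  (\int[P]_t ((`|Y t| ^+ (m + m))%:E + (`|Z t| ^+ (m + m))%:E))%E).
  apply: ge0_le_integral => //.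
  - exact: (measurable_absX m (measurable_funM mY mZ)).
  - by apply: emeasurable_funD; exact: measurable_absX.
  - move=> t _; rewrite -EFinD lee_fin normrM exprMn !exprD.
    set a := `|Y t| ^+ m; set b := `|Z t| ^+ m; nra.
rewrite ge0_integralD//; try exact: measurable_absX.
by rewrite lte_add_pinfty.
Qed.

Lemma has_moments_integrable (Y : T -> R) : has_moments Y ->
  P.-integrable setT (fun t => (Y t)%:E).
Proof.
move=> [mY hY]; apply/integrableP; split; first exact/measurable_EFinP.
by have := hY 1%N; under eq_integral do rewrite expr1.
Qed.

End Moments.

(** * Expectations of polynomials in random variables *)

Section PolynomialExpectation.
Context {R : realType} {dT : measure_display} {T : measurableType dT} (P : probability T R).
Context {I : Type} (g : I -> T -> R) (hg : forall i, has_moments P (g i)).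

Definition expect (m : (I -> R) -> R) : R := fine ('E_P[fun t => m (g^~ t)])%E.

Lemma polyfn_has_moments m : polyfn m -> has_moments P (fun t => m (g^~ t)).
Proof.
elim => [c|i|f1 f2 _ h1 _ h2|f1 f2 _ h1 _ h2].
- exact: has_moments_cst.
- exact: hg.
- exact: has_momentsD.
- exact: has_momentsM.
Qed.

Lemma polyfn_integrable m : polyfn m -> P.-integrable setT (fun t => (m (g^~ t))%:E).
Proof. by move=> pm; exact/has_moments_integrable/polyfn_has_moments. Qed.

Lemma expectD m1 m2 : polyfn m1 -> polyfn m2 ->
  expect (fun x => m1 x + m2 x) = expect m1 + expect m2.
Proof.
move=> p1 p2; have i1 := polyfn_integrable p1; have i2 := polyfn_integrable p2.
rewrite /expect unlock -fineD ?integrable_fin_num//.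
by rewrite -integralD.
Qed.

Lemma expectZ c m : polyfn m -> expect (fun x => c * m x) = c * expect m.
Proof.
move=> pm; have im := polyfn_integrable pm.
rewrite /expect unlock -[c in RHS]/(fine c%:E) -fineM ?integrable_fin_num//.
by rewrite -integralZl.
Qed.

Lemma expect_sum (J : finType) (F : J -> (I -> R) -> R) : (forall j, polyfn (F j)) ->
  expect (fun x => \sum_j F j x) = \sum_j expect (F j).
Proof.
move=> hF; pose H (s : seq J) := expect (fun x => \sum_(j <- s) F j x).
suff : forall s, H s = \sum_(j <- s) expect (F j) by apply.
elim=> [|j s IH].
  rewrite /H big_nil (_ : (fun x => _) = (fun x => 0 * 0)).
    by rewrite expectZ ?mul0r//; exact: polyfn_cst.
  by apply/funext => x; rewrite big_nil mul0r.
rewrite big_cons -IH -expectD//; last first.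
  elim: s {IH} => [|k s IHs].
    rewrite (_ : (fun x => _) = (fun=> 0)); first exact: polyfn_cst.
    by apply/funext => x; rewrite big_nil.
  rewrite (_ : (fun x => _) = (fun x => F k x + \sum_(j <- s) F j x)).
    exact: polyfnD.
  by apply/funext => x; rewrite big_cons.
by congr expect; apply/funext => x; rewrite big_cons.
Qed.

Lemma expect_ge0 m : (forall x, 0 <= m x) -> 0 <= expect m.
Proof.
move=> m0; rewrite /expect unlock fine_ge0// integral_ge0// => t _.
by rewrite lee_fin.
Qed.

(** Parameters on the left, random coordinates on the right: a function polynomial in both becomes a
    single [polyfn]. *)
Definition sumfun (J : Type) (a : J -> R) (x : I -> R) (k : J + I) : R :=
  match k with inl j => a j | inr i => x i end.

(** Expectation is not multiplicative, so a direct induction stops at products. Instead,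
    multiplication by [phi] is shown to preserve the class [good] of those [psi] whose expectation
    against every polynomial test function [m] is polynomial in [a]. A product of polynomials then
    acts by composition, and [psi = m = 1] gives the claim. *)
Lemma polyfn_expect (J : Type) (phi : (J + I -> R) -> R) : polyfn phi ->
  polyfn (fun a => expect (fun x => phi (sumfun a x))).
Proof.
pose good (psi : (J -> R) -> (I -> R) -> R) := (forall a, polyfn (psi a)) /\
  forall m, polyfn m -> polyfn (fun a => expect (fun x => psi a x * m x)).
move=> pphi.
suff H : forall psi, good psi -> good (fun a x => phi (sumfun a x) * psi a x).
  have g1 : good (fun _ _ => 1).
    by split=> [_|m pm]; exact: polyfn_cst.
  have [_ /(_ (fun=> 1) (polyfn_cst _ _))] := H _ g1.
  congr polyfn; apply/funext => a; congr expect; apply/funext => x.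
  by rewrite !mulr1.
elim: pphi => {phi} [c|[j|i]|f1 f2 _ h1 _ h2|f1 f2 _ h1 _ h2] psi gpsi;
  have [ppsi epsi] := gpsi; split.
- by move=> a; apply: polyfnM => //; exact: polyfn_cst.
- move=> m pm; rewrite (_ : (fun a => _) = (fun a => c * expect (fun x => psi a x * m x))).
    by apply: polyfnM; [exact: polyfn_cst|exact: epsi].
  apply/funext => a; rewrite -expectZ//; last exact: polyfnM.
  by congr expect; apply/funext => x; rewrite mulrA.
- by move=> a; apply: polyfnM => //; exact: polyfn_cst.
- move=> m pm; rewrite (_ : (fun a => _) = (fun a => a j * expect (fun x => psi a x * m x))).
    by apply: polyfnM; [exact: polyfn_var|exact: epsi].
  apply/funext => a; rewrite -expectZ//; last exact: polyfnM.
  by congr expect; apply/funext => x; rewrite mulrA.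
- by move=> a; apply: polyfnM => //; exact: polyfn_var.
- move=> m pm.
  rewrite (_ : (fun a => _) = (fun a => expect (fun x => psi a x * (x i * m x)))).
    by apply: epsi; apply: polyfnM => //; exact: polyfn_var.
  by apply/funext => a; congr expect; apply/funext => x /=; ring.
- have [k1 _] := h1 _ gpsi; have [k2 _] := h2 _ gpsi.
  move=> a; rewrite (_ : (fun x => _) =
      (fun x => f1 (sumfun a x) * psi a x + f2 (sumfun a x) * psi a x)).
    exact: polyfnD.
  by apply/funext => x; rewrite mulrDl.
- have [k1 e1] := h1 _ gpsi; have [k2 e2] := h2 _ gpsi; move=> m pm.
  rewrite (_ : (fun a => _) = (fun a => expect (fun x => f1 (sumfun a x) * psi a x * m x)
      + expect (fun x => f2 (sumfun a x) * psi a x * m x))).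
    by apply: polyfnD; [exact: e1|exact: e2].
  apply/funext => a; rewrite -expectD; [|exact: polyfnM..].
  by congr expect; apply/funext => x; rewrite !mulrDl.
- have [k _] := h1 _ (h2 _ gpsi) => a; have := k a.
  by congr polyfn; apply/funext => x; rewrite mulrA.
- have [_ e] := h1 _ (h2 _ gpsi) => m pm; have := e m pm.
  congr polyfn; apply/funext => a; congr expect; apply/funext => x.
  by rewrite !mulrA.
Qed.

End PolynomialExpectation.

(** * Signed permutations of a Gaussian family *)

Section JointLaw.
Context {R : realType} {I : finType}.

(** Boxes form a pi-system; the sigma-algebra that they generate carries the joint law on
    [I -> R]. *)
Definition boxes : set (set (I -> R)) :=
  [set A | exists2 B : I -> set R, (forall i, measurable (B i)) &
    A = [set x | forall i, B i (x i)]].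

Local Notation joint := (g_sigma_algebraType boxes).

Lemma polyfn_measurable (m : (I -> R) -> R) : polyfn m ->
  measurable_fun [set: joint] (m : joint -> R).
Proof.
elim => [c|i|f1 f2 _ h1 _ h2|f1 f2 _ h1 _ h2].
- exact: measurable_cst.
- move=> _ B mB; rewrite setTI; apply: sub_sigma_algebra.
  exists (fun j => if j == i then B else setT).
    by move=> j; case: ifP.
  apply/seteqP; split => x /=.
    by move=> Bx j; case: eqP => // ->.
  by move=> /(_ i); rewrite eqxx.
- exact: measurable_funD.
- exact: measurable_funM.
Qed.

Context {dT : measure_display} {T : measurableType dT} (P : probability T R).

Lemma measurable_joint (g : I -> T -> R) : (forall i, measurable_fun setT (g i)) ->
  @measurable_fun _ _ T joint setT (fun t => g^~ t).
Proof.
move=> mg; apply: (@measurability _ _ T joint setT (fun t => g^~ t) boxes erefl).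
move=> _ [_ [B mB ->] <-]; rewrite setTI.
rewrite (_ : _ @^-1` _ = \bigcap_(i in [set: I]) (g i @^-1` B i)).
  apply: fin_bigcap_measurable => // i _.
  by rewrite -[X in measurable X]setTI; exact: mg.
by apply/seteqP; split => t /= h i; [move=> _; exact: h|exact: (h i Logic.I)].
Qed.

(** The expectation depends only on the joint law. Independence fixes that law on boxes, and
    uniqueness of finite measures on a generating pi-system fixes it everywhere. *)
Lemma expect_iid_std_normal (g g' : I -> T -> R) (m : (I -> R) -> R) :
  iid_std_normal P g -> iid_std_normal P g' -> polyfn m ->
  expect P g m = expect P g' m.
Proof.
move=> [hg ig] [hg' ig'] pm.
have mg := measurable_joint (fun i => (hg i).1).
have mg' := measurable_joint (fun i => (hg' i).1).
pose law (h : I -> T -> R) (mh : @measurable_fun _ _ T joint setT (fun t => h^~ t)) :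
    {measure set joint -> \bar R} :=
  measure_function_pushforward__canonical__measure_function_Measure P mh.
have lawE h (mh : @measurable_fun _ _ T joint setT (fun t => h^~ t)) :
    (forall i, std_normal_rv P (h i)) ->
    expect P h m = fine (\int[law h mh]_x (m x)%:E)%E.
  move=> Nh; rewrite /expect unlock; congr fine.
  rewrite (integral_pushforward mh)//.
    by apply/measurable_EFinP; exact: polyfn_measurable.
  rewrite preimage_setT; apply: polyfn_integrable => // i.
  exact: has_moments_std_normal.
rewrite (lawE _ mg)// (lawE _ mg')//; congr fine.
apply: eq_measure_integral => A mA _.
have boxE h (mh : @measurable_fun _ _ T joint setT (fun t => h^~ t)) (B : I -> set R) :
    (forall i, measurable (B i)) -> (forall i, std_normal_rv P (h i)) ->
    mutually_independent P h ->
    law h mh [set x | forall i, B i (x i)] = (\prod_(i : I) normal_prob 0 1 (B i))%E.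
  move=> mB Nh indh; rewrite /= /pushforward.
  transitivity (P (\bigcap_(i in [set: I]) (h i @^-1` B i))).
    congr (P _); apply/seteqP; split => t /= hB i; first by move=> _; exact: hB.
    exact: (hB i Logic.I).
  by rewrite indh//; apply: eq_bigr => i _; rewrite (Nh i).2.
apply: (@measure_unique _ R joint boxes (fun=> setT) erefl _ _ _ (law _ mg) (law _ mg')) => //.
- move=> _ _ [B mB ->] [C mC ->]; exists (fun i => B i `&` C i).
    by move=> i; exact: measurableI.
  apply/seteqP; split => x /=; first by move=> [hB hC] i; split.
  by move=> h; split=> i; have [] := h i.
- move=> _; exists (fun=> setT) => //.
  by apply/seteqP; split.
- by apply/seteqP; split => // x _; exists 0%N.
- by move=> _ [B mB ->]; rewrite !boxE.
- move=> _; rewrite /= /pushforward preimage_setT.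
  exact: le_lt_trans (probability_le1 P measurableT) (ltry 1).
Qed.

Definition signed_perm (s : I -> bool) (p : I -> I) (x : I -> R) (i : I) : R :=
  if s i then - x (p i) else x (p i).

(** A sign is moved into the Borel set, where symmetry of the normal law absorbs it. Independence
    survives by reindexing along [p], which is invertible as an injection of a finite type into
    itself. *)
Lemma iid_signed_perm (g : I -> T -> R) (s : I -> bool) (p : I -> I) :
  injective p -> iid_std_normal P g ->
  iid_std_normal P (fun i t => signed_perm s p (g^~ t) i).
Proof.
move=> injp [hg ig].
pose opp (B : set R) := (fun x : R => - x) @^-1` B.
have mopp B : measurable B -> measurable (opp B).
  by move=> mB; rewrite -[X in measurable X]setTI; exact: oppr_measurable.
pose B' (B : set R) i := if s i then opp B else B.
have mB' B i : measurable B -> measurable (B' B i).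
  by move=> mB; rewrite /B'; case: ifP => // _; exact: mopp.
have preE B i : (fun t => signed_perm s p (g^~ t) i) @^-1` B = g (p i) @^-1` B' B i.
  by apply/seteqP; split => t; rewrite /signed_perm /B' /=; case: (s i).
have PE B i : measurable B ->
    P ((fun t => signed_perm s p (g^~ t) i) @^-1` B) = normal_prob 0 1 B.
  move=> mB; rewrite preE (hg (p i)).2; last exact: mB'.
  by rewrite /B'; case: ifP => // _; exact: normal_prob_opp.
split.
  move=> i; split=> [|B mB]; last exact: PE.
  move=> _ B mB; rewrite setTI preE -[X in measurable X]setTI.
  by apply: (hg (p i)).1 => //; exact: mB'.
move=> B mB.
have pK := f_invF injp; have Kp := invF_f injp.
transitivity (P (\bigcap_(j in [set: I]) (g j @^-1` B' (B (invF injp j)) (invF injp j)))).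
  congr (P _); apply/seteqP; split => t /= h i _.
    by have := h (invF injp i) Logic.I; rewrite preE /= pK.
  by rewrite preE /=; have := h (p i) Logic.I; rewrite /= Kp.
rewrite ig; last by move=> j; exact: mB'.
rewrite (reindex_onto p (invF injp)) => [|j _]; last exact: pK.
rewrite (eq_bigl xpredT) => [|i]; last by rewrite Kp eqxx.
by apply: eq_bigr => i _; rewrite Kp preE.
Qed.

Lemma expect_signed_perm (g : I -> T -> R) (s : I -> bool) (p : I -> I)
  (m : (I -> R) -> R) : injective p -> iid_std_normal P g -> polyfn m ->
  expect P g (fun x => m (signed_perm s p x)) = expect P g m.
Proof.
by move=> injp hg pm; rewrite [RHS](expect_iid_std_normal hg (iid_signed_perm s injp hg)).
Qed.

End JointLaw.

(** * The linear transformer *)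

Section Readout.
Context {R : realType} {d n k : nat}.
Implicit Types (A B : 'I_k.+1 -> 'M[R]_d) (X : 'M[R]_(d, n + 1)).

Fixpoint feat A B X (m : nat) : 'M[R]_(d, n + 1) :=
  if m is m'.+1 then
    feat A B X m' + n%:R^-1 *: (B (inord m') *m feat A B X m' *m Mmask R n *m
      ((feat A B X m')^T *m A (inord m') *m feat A B X m'))
  else X.

Fixpoint coef A B X (m : nat) : 'M[R]_(d, n + 1) :=
  if m is m'.+1 then
    coef A B X m' + n%:R^-1 *: (coef A B X m' *m Mmask R n *m
      ((feat A B X m')^T *m A (inord m') *m feat A B X m'))
  else X *m Mmask R n.

(** The query column. The summand [X] comes from [w^T x^(n+1)] in the loss, which thus becomes the
    second moment of the pairing of this vector with [w]. *)
Definition residual A B X : 'cV[R]_d :=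
  col (rshift n ord0) (coef A B X k.+1 + X).

(* The label row of every iterate is linear in [w]; [coef] is its coefficient
   and [feat] the block of the first [d] rows. *)
Lemma Zit_col_mx A B X (w : 'cV[R]_d) m :
  Zit A B X w m = col_mx (feat A B X m) (w^T *m coef A B X m).
Proof.
elim: m => [|m IH] /=.
  rewrite /Z0; congr col_mx.
  rewrite -[X in _ = _ *m (X *m _)]hsubmxK /Mmask mul_row_block.
  rewrite !mulmx0 !addr0 mulmx1 mul_mx_row mulmx0; congr row_mx.
  apply/rowP => j; rewrite !mxE; apply: eq_bigr => l _.
  by rewrite !mxE mulrC.
rewrite IH /lt_step /Pmat /Qmat mul_block_col !mul0mx addr0 add0r mul1mx.
rewrite tr_col_mx mul_row_block !mulmx0 !addr0 mul_row_col mul0mx addr0.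
by rewrite !mul_col_mx scale_col_mx add_col_mx mulmxDr -scalemxAr !mulmxA.
Qed.

Lemma lt_pred_residual A B X (w : 'cV[R]_d) :
  lt_pred A B X w + \sum_(l < d) w l 0 * X l (rshift n ord0) =
  \sum_(l < d) w l 0 * residual A B X l 0.
Proof.
rewrite /lt_pred Zit_col_mx col_mxEd /residual.
move: (coef A B X k.+1) => C; rewrite mxE -big_split /=.
by apply: eq_bigr => l _; rewrite !mxE mulrDr.
Qed.

(** Under the change of basis [W], [A] transforms as a bilinear form and [B] as an endomorphism. The
    scores [feat^T A feat] stay fixed, and every iterate picks up a left factor [W]. *)
Lemma residual_equivariant A B X (W W' : 'M[R]_d) : W' *m W = 1%:M ->
  residual (fun i => W'^T *m A i *m W') (fun i => W *m B i *m W') (W *m X) =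
  W *m residual A B X.
Proof.
move=> W'W; pose A' i := W'^T *m A i *m W'; pose B' i := W *m B i *m W'.
have cancelA m (Y : 'M[R]_(d, n + 1)) :
    (W *m Y)^T *m A' m *m (W *m Y) = Y^T *m A m *m Y.
  rewrite trmx_mul /A' !mulmxA -(mulmxA _ W' W) W'W mulmx1.
  by rewrite -(mulmxA _ W^T W'^T) -trmx_mul W'W trmx1 mulmx1.
have featE m : feat A' B' (W *m X) m = W *m feat A B X m.
  elim: m => //= m ->; rewrite cancelA mulmxDr -scalemxAr; congr (_ + _ *: _).
  by rewrite /B' !mulmxA -(mulmxA _ W' W) W'W mulmx1.
have coefE m : coef A' B' (W *m X) m = W *m coef A B X m.
  elim: m => /= [|m ->]; first by rewrite mulmxA.
  by rewrite featE cancelA mulmxDr -scalemxAr !mulmxA.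
by rewrite /residual coefE -mulmxDr !colE mulmxA.
Qed.

End Readout.

(** * Polynomial dependence of the residual on parameters and data *)

Section PolynomialMatrices.
Context {R : realType} {I : Type}.

Definition mxpolyfn a b (F : (I -> R) -> 'M[R]_(a, b)) : Prop :=
  forall i j, polyfn (fun x => F x i j).

Lemma mxpolyfn_cst a b (M : 'M[R]_(a, b)) : mxpolyfn (fun=> M).
Proof. by move=> i j; exact: polyfn_cst. Qed.

Lemma mxpolyfnD a b (F G : (I -> R) -> 'M[R]_(a, b)) :
  mxpolyfn F -> mxpolyfn G -> mxpolyfn (fun x => F x + G x).
Proof.
move=> hF hG i j; rewrite (_ : (fun x => _) = (fun x => F x i j + G x i j)).
  exact: polyfnD.
by apply/funext => x; rewrite mxE.
Qed.

Lemma mxpolyfnM a b c (F : (I -> R) -> 'M[R]_(a, b)) (G : (I -> R) -> 'M[R]_(b, c)) :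
  mxpolyfn F -> mxpolyfn G -> mxpolyfn (fun x => F x *m G x).
Proof.
move=> hF hG i j; rewrite (_ : (fun x => _) = (fun x => \sum_l F x i l * G x l j)).
  by apply: polyfn_sum => l; exact: polyfnM.
by apply/funext => x; rewrite mxE.
Qed.

Lemma mxpolyfnZ a b (c : R) (F : (I -> R) -> 'M[R]_(a, b)) :
  mxpolyfn F -> mxpolyfn (fun x => c *: F x).
Proof.
move=> hF i j; rewrite (_ : (fun x => _) = (fun x => c * F x i j)).
  by apply: polyfnM => //; exact: polyfn_cst.
by apply/funext => x; rewrite mxE.
Qed.

Lemma mxpolyfn_tr a b (F : (I -> R) -> 'M[R]_(a, b)) :
  mxpolyfn F -> mxpolyfn (fun x => (F x)^T).
Proof.
move=> hF i j; rewrite (_ : (fun x => _) = (fun x => F x j i)) //.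
by apply/funext => x; rewrite mxE.
Qed.

(** All three arguments depend on a common variable, so that the lemma covers both frozen parameters
    with random data and parameters and data varying jointly. *)
Lemma mxpolyfn_residual d n k (A B : (I -> R) -> 'I_k.+1 -> 'M[R]_d)
    (X : (I -> R) -> 'M[R]_(d, n + 1)) :
  (forall i, mxpolyfn (A^~ i)) -> (forall i, mxpolyfn (B^~ i)) -> mxpolyfn X ->
  mxpolyfn (fun x => residual (A x) (B x) (X x)).
Proof.
move=> hA hB hX.
have hfeat m : mxpolyfn (fun x => feat (A x) (B x) (X x) m).
  elim: m => //= m IH; apply: mxpolyfnD => //; apply: mxpolyfnZ.
  apply: mxpolyfnM; first apply: mxpolyfnM; first apply: mxpolyfnM.
  - exact: hB.
  - exact: IH.
  - exact: mxpolyfn_cst.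
  - by apply: mxpolyfnM => //; apply: mxpolyfnM; [exact: mxpolyfn_tr|exact: hA].
have hcoef m : mxpolyfn (fun x => coef (A x) (B x) (X x) m).
  elim: m => /= [|m IH]; first by apply: mxpolyfnM => //; exact: mxpolyfn_cst.
  apply: mxpolyfnD => //; apply: mxpolyfnZ.
  apply: mxpolyfnM; first apply: mxpolyfnM.
  - exact: IH.
  - exact: mxpolyfn_cst.
  - by apply: mxpolyfnM => //; apply: mxpolyfnM; [exact: mxpolyfn_tr|exact: hA].
move=> i j; rewrite (_ : (fun x => _) =
    (fun x => (coef (A x) (B x) (X x) k.+1 + X x) i (rshift n ord0))).
  exact: (mxpolyfnD (hcoef k.+1) hX).
by apply/funext => x; rewrite mxE.
Qed.

End PolynomialMatrices.

(** * Linear forms on matrices invariant under signed permutations *)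

Section TraceFunctional.
Context {R : realType} {d : nat}.

(* Conjugation by a sign flip kills the off-diagonal coefficients, conjugation
   by a transposition identifies the diagonal ones. *)
Lemma trace_functional (alpha : 'M[R]_d -> R) (l0 : 'I_d) :
  (forall a N M, alpha (a *: N + M) = a * alpha N + alpha M) ->
  (forall (p : 'I_d) N,
     alpha (diag_mx (\row_l (-1) ^+ (l == p)) *m N *m
            diag_mx (\row_l (-1) ^+ (l == p))) = alpha N) ->
  (forall (s : {perm 'I_d}) N, alpha (perm_mx s *m N *m (perm_mx s)^T) = alpha N) ->
  forall N, alpha N = \tr N * (alpha 1%:M / d%:R).
Proof.
move=> alpha_lin flip perm.
pose c p q := alpha (delta_mx p q).
have alpha0 : alpha 0 = 0.
  by have := alpha_lin 1 0 0; rewrite scale1r addr0 => h; lra.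
have alphaD N M : alpha (N + M) = alpha N + alpha M.
  by rewrite -[N in LHS]scale1r alpha_lin mul1r.
have alphaZ a N : alpha (a *: N) = a * alpha N.
  by rewrite -[_ *: _]addr0 alpha_lin alpha0 addr0.
have alphaE N : alpha N = \sum_p \sum_q N p q * c p q.
  rewrite {1}(matrix_sum_delta N) (big_morph alpha alphaD alpha0).
  apply: eq_bigr => p _; rewrite (big_morph alpha alphaD alpha0).
  by apply: eq_bigr => q _; rewrite alphaZ.
have alpha_delta p q : alpha (delta_mx p q) = c p q by [].
have c_off p q : p != q -> c p q = 0.
  move=> pq; have := flip p (delta_mx p q).
  rewrite (_ : _ *m _ = - delta_mx p q); last first.
    apply/matrixP => i j; rewrite mul_mx_diag mul_diag_mx !mxE.
    have [_|_] := eqVneq i p; last by rewrite mulr0 mul0r oppr0.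
    have [->|_] := eqVneq j q; last by rewrite mulr0 mul0r oppr0.
    by rewrite eq_sym (negbTE pq) expr1 expr0 !mulr1.
  have -> : alpha (- delta_mx p q) = - alpha (delta_mx p q).
    rewrite !alphaE -sumrN; apply: eq_bigr => i _; rewrite -sumrN.
    by apply: eq_bigr => j _; rewrite mxE mulNr.
  by rewrite alpha_delta => h; lra.
have c_diag p : c p p = c l0 l0.
  have := perm (tperm p l0) (delta_mx p p).
  rewrite (_ : _ *m _ = delta_mx l0 l0) ?alpha_delta//.
  apply/matrixP => i j; rewrite tr_perm_mx -row_permE -col_permE !mxE.
  have tpE l : (tperm p l0 l == p) = (l == l0).
    by rewrite -(inj_eq (@perm_inj _ (tperm p l0)) l l0) tpermR.
  by rewrite !tpE.
have alphaT N : alpha N = \tr N * c l0 l0.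
  rewrite alphaE /mxtrace mulr_suml; apply: eq_bigr => p _.
  rewrite (bigD1 p)//= c_diag big1 ?addr0// => q qp.
  by rewrite c_off ?mulr0// eq_sym.
(* The identity has trace [d], so the common diagonal value is [alpha 1 / d]; the index [l0]
   certifies [d > 0]. *)
move=> N; rewrite !alphaT mxtrace1 [_ * c l0 l0 / _]mulrAC divff ?mul1r//.
by rewrite pnatr_eq0 -lt0n (leq_ltn_trans _ (ltn_ord l0)).
Qed.

End TraceFunctional.

(** * Second moments along the coordinates of the task vector *)

Section Isotropy.
Context {R : realType} {dT : measure_display} {T : measurableType dT} (P : probability T R).
Context {I J : finType} (g : I + J -> T -> R) (hg : iid_std_normal P g).

(* Flipping the sign of [x (inr j)] kills the cross terms; swapping
   [x (inr j)] and [x (inr j0)] identifies the diagonal ones. *)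
Lemma expect_isotropic (q : J -> (I + J -> R) -> R) (j0 : J) :
  (forall j, polyfn (q j)) ->
  (forall j x y, (forall i, x (inl i) = y (inl i)) -> q j x = q j y) ->
  expect P g (fun x => (\sum_j x (inr j) * q j x) ^+ 2) =
  expect P g (fun x => x (inr j0) ^+ 2 * \sum_j q j x ^+ 2).
Proof.
move=> pq qinl.
have hm i : has_moments P (g i) by apply: has_moments_std_normal; exact: hg.1.
pose F j j' (x : I + J -> R) := x (inr j) * x (inr j') * (q j x * q j' x).
have pF j j' : polyfn (F j j').
  by apply: polyfnM; apply: polyfnM => //; exact: polyfn_var.
have pG j : polyfn (fun x : I + J -> R => x (inr j0) * x (inr j0) * (q j x * q j x)).
  by apply: polyfnM; apply: polyfnM => //; exact: polyfn_var.
rewrite (_ : (fun x => (\sum_j _) ^+ 2) = (fun x => \sum_j \sum_j' F j j' x)); last first.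
  apply/funext => x; rewrite expr2 mulr_suml; apply: eq_bigr => j _.
  by rewrite mulr_sumr; apply: eq_bigr => j' _; rewrite /F; ring.
rewrite (_ : (fun x => _ ^+ 2 * _) =
    (fun x => \sum_j x (inr j0) * x (inr j0) * (q j x * q j x))); last first.
  apply/funext => x; rewrite mulr_sumr; apply: eq_bigr => j _.
  by rewrite !expr2.
rewrite !expect_sum//; last by move=> j; exact: polyfn_sum.
apply: eq_bigr => j _; rewrite expect_sum// (bigD1 j)//= big1 ?addr0 => [|j' jj'].
  pose p (i : I + J) := match i with inl i => inl i | inr i => inr (tperm j j0 i) end.
  have injp : injective p.
    by move=> [i|i] [i'|i'] //= [] /perm_inj->.
  rewrite -(expect_signed_perm (fun=> false) injp hg)//.
  congr expect; apply/funext => x; rewrite /F /signed_perm /= tpermL.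
  by rewrite (qinl j _ x).
pose s (i : I + J) := if i is inr i then i == j else false.
have := expect_signed_perm s (@inj_id _) hg (pF j j').
have -> : (fun x => F j j' (signed_perm s id x)) = (fun x => -1 * F j j' x).
  apply/funext => x; rewrite /F /signed_perm /= eqxx (negbTE jj').
  by rewrite (qinl j _ x)// (qinl j' _ x)//; ring.
by rewrite expectZ// => h; lra.
Qed.

End Isotropy.

(** * Symmetries of the loss *)

Section LossInvariance.
Context {R : realType} {d n k : nat} {dT : measure_display} {T : measurableType dT}
  (P : probability T R).
Context (g : ('I_(n + 1) * 'I_d + 'I_d)%type -> T -> R) (hg : iid_std_normal P g).
Context (L Lw : 'M[R]_d).

Local Notation K := ('I_(n + 1) * 'I_d + 'I_d)%type.

Definition gaussX (x : K -> R) : 'M[R]_(d, n + 1) := \matrix_(l, i) x (inl (i, l)).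

Definition gaussw (x : K -> R) : 'cV[R]_d := \col_l x (inr l).

Definition gloss (A B : 'I_k.+1 -> 'M[R]_d) : R :=
  lt_loss P (fun t => L *m gaussX (g^~ t)) (fun t => Lw *m gaussw (g^~ t)) A B.

Lemma glossE A B : gloss A B = expect P g (fun x =>
  (\sum_l (Lw *m gaussw x) l 0 * residual A B (L *m gaussX x) l 0) ^+ 2).
Proof.
rewrite /gloss /lt_loss /expect; congr (fine (expectation P _)).
by apply/funext => t; rewrite lt_pred_residual.
Qed.

Lemma gloss_ge0 A B : 0 <= gloss A B.
Proof. by rewrite glossE; apply: expect_ge0 => x; rewrite sqr_ge0. Qed.

Lemma mxpolyfn_gaussX (I : Type) (s : (I -> R) -> K -> R) :
  (forall i, polyfn (fun x => s x i)) -> mxpolyfn (fun x => gaussX (s x)).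
Proof.
move=> hs i j; rewrite (_ : (fun x => _) = (fun x => s x (inl (j, i)))) //.
by apply/funext => x; rewrite mxE.
Qed.

Lemma mxpolyfn_gaussw (I : Type) (s : (I -> R) -> K -> R) :
  (forall i, polyfn (fun x => s x i)) -> mxpolyfn (fun x => gaussw (s x)).
Proof.
move=> hs i j; rewrite (_ : (fun x => _) = (fun x => s x (inr i))) //.
by apply/funext => x; rewrite mxE.
Qed.

Lemma polyfn_residual A B l :
  polyfn (fun x : K -> R => @residual R d n k A B (L *m gaussX x) l 0).
Proof.
apply: (mxpolyfn_residual (A := fun=> A) (B := fun=> B)) => [i|i|].
- exact: mxpolyfn_cst.
- exact: mxpolyfn_cst.
- apply: mxpolyfnM; first exact: mxpolyfn_cst.
  by apply: (mxpolyfn_gaussX (s := id)) => i; exact: polyfn_var.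
Qed.

(** Reduces [w] to its covariance [Lw Lw^T], so that a symmetry can act on the samples alone. The
    factor [x (inr l0) ^+ 2] stays inside the expectation, where symmetries that fix the [inr]
    coordinates leave it alone. *)
Lemma gloss_isotropic A B (l0 : 'I_d) : gloss A B = expect P g (fun x =>
  x (inr l0) ^+ 2 * ((residual A B (L *m gaussX x))^T *m (Lw *m Lw^T) *m
                      residual A B (L *m gaussX x)) 0 0).
Proof.
pose r x := @residual R d n k A B (L *m gaussX x).
pose q l x := (Lw^T *m r x) l 0.
have pq l : polyfn (q l).
  apply: (mxpolyfnM (mxpolyfn_cst _)) => i j; rewrite [j]ord1.
  exact: polyfn_residual.
have qinl l (x y : K -> R) : (forall i, x (inl i) = y (inl i)) -> q l x = q l y.
  move=> xy; rewrite /q /r (_ : gaussX x = gaussX y)//.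
  by apply/matrixP => i j; rewrite !mxE xy.
rewrite glossE; transitivity (expect P g (fun x => (\sum_l x (inr l) * q l x) ^+ 2)).
  congr expect; apply/funext => x; congr (_ ^+ 2).
  have mulE (u v : 'cV[R]_d) : \sum_l u l 0 * v l 0 = (u^T *m v) 0 0.
    by rewrite mxE; apply: eq_bigr => l _; rewrite mxE.
  rewrite [RHS](eq_bigr (fun l => gaussw x l 0 * (Lw^T *m r x) l 0)); last first.
    by move=> l _; rewrite [gaussw x l 0]mxE.
  by rewrite !mulE trmx_mul mulmxA.
rewrite (expect_isotropic hg l0)//; congr expect; apply/funext => x; congr (_ * _).
rewrite mulmxA -mulmxA -[Lw in X in X *m _]trmxK -trmx_mul mxE.
by apply: eq_bigr => l _; rewrite mxE expr2.
Qed.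

(** [W] is the orthogonal map [U] of the whitened samples, read in the original coordinates. It
    multiplies the residual by [W], which disappears because [W] preserves the quadratic form
    [(invmx L)^T *m invmx L], the covariance of [w]. *)
Lemma gloss_conj A B (s : K -> bool) (p : K -> K) (U : 'M[R]_d) (l0 : 'I_d) :
  injective p -> (forall x, gaussX (signed_perm s p x) = U *m gaussX x) ->
  (forall (x : K -> R) l, signed_perm s p x (inr l) = x (inr l)) ->
  U *m U^T = 1%:M -> L \in unitmx -> Lw *m Lw^T = (invmx L)^T *m invmx L ->
  let W := L *m U *m invmx L in let W' := L *m U^T *m invmx L in
  gloss (fun i => W'^T *m A i *m W') (fun i => W *m B i *m W') = gloss A B.
Proof.
move=> injp XU wU UU Lu LwE W W'.
have UU' : U^T *m U = 1%:M by exact: mulmx1C.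
have W'W : W' *m W = 1%:M.
  by rewrite /W /W' !mulmxA mulmxKV// -(mulmxA L) UU' mulmx1 mulmxV.
rewrite !(gloss_isotropic _ _ l0).
set A' := fun i => W'^T *m A i *m W'; set B' := fun i => W *m B i *m W'.
(* On the side of the conjugated parameters the Gaussians are replaced by their signed permutation;
   the two integrands then agree pointwise. *)
rewrite -(expect_signed_perm s injp hg); last first.
  apply: polyfnM; first by apply: polyfnM; exact: polyfn_var.
  have pr : mxpolyfn (fun x : K -> R => residual A' B' (L *m gaussX x)).
    by move=> i j; rewrite [j]ord1; exact: polyfn_residual.
  apply: mxpolyfnM => //; apply: mxpolyfnM; last exact: mxpolyfn_cst.
  exact: mxpolyfn_tr.
congr expect; apply/funext => x; rewrite wU XU; congr (_ * _).
have -> : L *m (U *m gaussX x) = W *m (L *m gaussX x).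
  by rewrite /W -!mulmxA (mulmxA (invmx L)) mulVmx// mul1mx.
rewrite residual_equivariant//; set r := residual A B _.
have WW : W^T *m (Lw *m Lw^T) *m W = Lw *m Lw^T.
  rewrite LwE /W !trmx_mul !mulmxA mulmxKV//.
  rewrite -(mulmxA _ L^T) -(trmx_mul (invmx L) L) mulVmx// trmx1 mulmx1 -(mulmxA _ U^T) UU'.
  by rewrite mulmx1.
rewrite -[in RHS]WW trmx_mul; congr (fun_of_matrix _ 0 0).
by rewrite !mulmxA.
Qed.

End LossInvariance.

Lemma posdef_unitmx {R : realType} {d : nat} (S : 'M[R]_d) : posdef S -> S \in unitmx.
Proof.
move=> [_ pS]; rewrite unitmxE unitfE; apply/negP => /det0P[v v0 vS].
have vT0 : v^T != 0 by rewrite -trmx0 (inj_eq trmx_inj).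
by have := pS _ vT0; rewrite trmxK vS mul0mx mxE ltxx.
Qed.

Lemma mxtrace_delta_mul {R : realType} {d : nat} (S : 'M[R]_d) (i j : 'I_d) :
  \tr (delta_mx i j *m S) = S j i.
Proof.
rewrite /mxtrace (bigD1 i)//= mxE (bigD1 j)//= !mxE !eqxx mul1r.
rewrite big1 => [|l lj]; last by rewrite mxE (negbTE lj) andbF mul0r.
rewrite big1 ?addr0// => l li; rewrite mxE big1// => m _.
by rewrite mxE (negbTE li) mul0r.
Qed.

(** * The differential of the loss at scalar points *)

Section Gradient.
Context {R : realType} {d n k : nat} {dT : measure_display} {T : measurableType dT}
  (P : probability T R).
Context (g : ('I_(n + 1) * 'I_d + 'I_d)%type -> T -> R) (hg : iid_std_normal P g).
Context (L Lw : 'M[R]_d) (Lu : L \in unitmx)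
  (LwE : Lw *m Lw^T = (invmx L)^T *m invmx L) (l0 : 'I_d).

Local Notation K := ('I_(n + 1) * 'I_d + 'I_d)%type.

(* [(true, i, (p, q))] indexes the entry [(p, q)] of [A_i], and
   [(false, i, (p, q))] that of [B_i]. *)
Definition param := (bool * 'I_k.+1 * ('I_d * 'I_d))%type.

Definition pmat (a : param -> R) (c : bool) (i : 'I_k.+1) : 'M[R]_d :=
  \matrix_(p, q) a (c, i, (p, q)).

Definition pvec (M : bool -> 'I_k.+1 -> 'M[R]_d) (x : param) : R :=
  M x.1.1 x.1.2 x.2.1 x.2.2.

Lemma pmatK M c i : pmat (pvec M) c i = M c i.
Proof. by apply/matrixP => p q; rewrite mxE. Qed.

Definition ploss (a : param -> R) : R := gloss P g L Lw (pmat a true) (pmat a false).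

(** The integrand is one polynomial [phi] in parameters and Gaussians together; [polyfn_expect]
    integrates out the Gaussians. *)
Lemma polyfn_ploss : polyfn ploss.
Proof.
pose phi (y : param + K -> R) := (\sum_l
  (Lw *m gaussw (fun x => y (inr x))) l 0 *
  residual (pmat (fun x => y (inl x)) true) (pmat (fun x => y (inl x)) false)
    (L *m gaussX (fun x => y (inr x))) l 0) ^+ 2.
have pphi : polyfn phi.
  pose psi (y : param + K -> R) := \sum_l
    (Lw *m gaussw (fun x => y (inr x))) l 0 *
    residual (pmat (fun x => y (inl x)) true) (pmat (fun x => y (inl x)) false)
      (L *m gaussX (fun x => y (inr x))) l 0.
  have ppsi : polyfn psi.
    apply: polyfn_sum => l; apply: polyfnM.
      apply: (mxpolyfnM (mxpolyfn_cst _)).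
      by apply: mxpolyfn_gaussw => i; exact: polyfn_var.
    have pm c i : mxpolyfn (fun y : param + K -> R => pmat (fun x => y (inl x)) c i).
      move=> p q; rewrite (_ : (fun x => _) = (fun x => x (inl (c, i, (p, q))))).
        exact: polyfn_var.
      by apply/funext => x; rewrite mxE.
    apply: (mxpolyfn_residual (pm true) (pm false)).
    apply: (mxpolyfnM (mxpolyfn_cst _)).
    by apply: mxpolyfn_gaussX => i; exact: polyfn_var.
  have := polyfnM ppsi ppsi; congr polyfn.
have hm i : has_moments P (g i) by apply: has_moments_std_normal; exact: hg.1.
have := polyfn_expect hm pphi; congr polyfn; apply/funext => a.
by rewrite /ploss glossE.
Qed.

(* In the coordinates [A = L^-T A' L^-1], [B = L B' L^-1] the covariance is the
   identity, and the points [A = a Sigma^-1], [B = b I] become [A' = a I],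
   [B' = b I]. *)
Definition dewhiten (c : bool) (N : 'M[R]_d) : 'M[R]_d :=
  if c then (invmx L)^T *m N *m invmx L else L *m N *m invmx L.

Definition whiten (c : bool) (N : 'M[R]_d) : 'M[R]_d :=
  if c then L^T *m N *m L else invmx L *m N *m L.

Lemma whitenK c N : dewhiten c (whiten c N) = N.
Proof.
rewrite /dewhiten /whiten; case: c; rewrite !mulmxA mulmxK//.
  by rewrite -trmx_mul mulmxV// trmx1 mul1mx.
by rewrite mulmxV// mul1mx.
Qed.

Lemma dewhitenK c N : whiten c (dewhiten c N) = N.
Proof.
rewrite /dewhiten /whiten; case: c; rewrite !mulmxA mulmxKV//.
  by rewrite -trmx_mul mulVmx// trmx1 mul1mx.
by rewrite mulVmx// mul1mx.
Qed.

Lemma dewhiten_linear c a N M : dewhiten c (a *: N + M) = a *: dewhiten c N + dewhiten c M.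
Proof. by case: c; rewrite /= mulmxDr mulmxDl -scalemxAr -scalemxAl. Qed.

(** Since [U] is orthogonal, bilinear forms and endomorphisms obey the same rule [N -> U N U^T] in
    whitened coordinates. *)
Lemma ploss_conj (s : K -> bool) (p : K -> K) (U : 'M[R]_d) M :
  injective p -> (forall x : K -> R, gaussX (signed_perm s p x) = U *m gaussX x) ->
  (forall (x : K -> R) l, signed_perm s p x (inr l) = x (inr l)) ->
  U *m U^T = 1%:M ->
  ploss (pvec (fun c i => dewhiten c (U *m whiten c (M c i) *m U^T))) = ploss (pvec M).
Proof.
move=> injp XU wU UU.
have := @gloss_conj R d n k _ _ P g hg L Lw (M true) (M false) s p U l0 injp XU wU UU Lu LwE.
rewrite /ploss /= => E.
have pE (M' : bool -> 'I_k.+1 -> 'M[R]_d) c : pmat (pvec M') c = M' c.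
  by apply/funext => i; rewrite pmatK.
rewrite !pE -E; congr gloss; apply/funext => i.
  by rewrite /dewhiten /whiten /= !trmx_mul trmxK !mulmxA.
by rewrite /dewhiten /whiten /= !mulmxA.
Qed.

Definition dloss (a v : param -> R) : R := \sum_x v x * partial x ploss a.

Lemma dloss_val a v : derive1 (fun t : R => ploss (fun x => a x + t * v x)) 0 = dloss a v.
Proof.
by rewrite derive1E; exact: (@derive_val _ _ _ _ _ _ _ (polyfn_line _ _ polyfn_ploss)).
Qed.

Definition dir (c : bool) (i : 'I_k.+1) (N : 'M[R]_d) : param -> R :=
  pvec (fun c' i' => if (c', i') == (c, i) then N else 0).

Definition scalar_point (y : bool -> 'I_k.+1 -> R) : param -> R :=
  pvec (fun c i => dewhiten c (y c i)%:M).

Section AtScalarPoint.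
Context (y : bool -> 'I_k.+1 -> R).
Local Notation a0 := (scalar_point y).

(** The differential at the scalar point, restricted to one block and read in whitened
    directions. *)
Definition alpha c i (N : 'M[R]_d) : R := dloss a0 (dir c i (dewhiten c N)).

Lemma alpha_linear c i a N M : alpha c i (a *: N + M) = a * alpha c i N + alpha c i M.
Proof.
rewrite /alpha /dloss mulr_sumr -big_split; apply: eq_bigr => -[[c' i'] [p q]] _.
rewrite /= mulrA -mulrDl; congr (_ * _); rewrite /dir /pvec /=.
by case: eqP => _; rewrite ?dewhiten_linear !mxE// mulr0 addr0.
Qed.

(** Scalar matrices commute with [U]: conjugating all blocks at once fixes the base point and
    conjugates only the direction, so the loss agrees along the two whole lines. *)
Lemma alpha_conj (s : K -> bool) (p : K -> K) (U : 'M[R]_d) c i N :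
  injective p -> (forall x : K -> R, gaussX (signed_perm s p x) = U *m gaussX x) ->
  (forall (x : K -> R) l, signed_perm s p x (inr l) = x (inr l)) ->
  U *m U^T = 1%:M -> alpha c i (U *m N *m U^T) = alpha c i N.
Proof.
move=> injp XU wU UU.
rewrite /alpha -(dloss_val a0 (dir c i (dewhiten c N))).
rewrite -(dloss_val a0 (dir c i (dewhiten c (U *m N *m U^T)))).
congr (derive1 _ 0); apply/funext => t.
have lineE N' : (fun x => a0 x + t * dir c i (dewhiten c N') x) =
    pvec (fun c' i' => dewhiten c' ((t * ((c', i') == (c, i))%:R) *: N' + (y c' i')%:M)).
  apply/funext => -[[c' i'] [p' q']]; rewrite /scalar_point /dir /pvec /=.
  rewrite dewhiten_linear mxE [X in _ = X + _]mxE addrC; congr (_ + _).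
  case: eqP => [[-> _]|_]; first by rewrite mulr1.
  by rewrite mxE !mulr0 mul0r.
rewrite !lineE -[RHS](ploss_conj _ injp XU wU UU); congr (ploss (pvec _)).
apply/funext => c'; apply/funext => i'; rewrite dewhitenK; congr dewhiten.
rewrite mulmxDr mulmxDl -!scalemxAr -scalemxAl; congr (_ + _).
by rewrite mul_mx_scalar -scalemxAl UU scalemx1.
Qed.

Lemma alpha_trace c i N : alpha c i N = \tr N * (alpha c i 1%:M / d%:R).
Proof.
apply: (trace_functional l0).
- exact: alpha_linear.
- move=> p M.
  (* Flips coordinate [p] of every sample at once and leaves [w] alone. *)
  pose s (x : K) := if x is inl x' then x'.2 == p else false.
  set D := diag_mx _.
  have DT : D^T = D by exact: tr_diag_mx.
  have -> : D *m M *m D = D *m M *m D^T by rewrite DT.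
  apply: (alpha_conj (s := s) (p := id)) => //.
  + move=> x; apply/matrixP => l j; rewrite mul_diag_mx !mxE /signed_perm /=.
    by case: eqP => _; rewrite ?expr1 ?expr0 ?mul1r ?mulN1r.
  + rewrite DT mulmx_diag; apply/matrixP => l j; rewrite !mxE.
    by rewrite -expr2 sqrr_sign.
- move=> s M.
  (* Permutes the coordinates in the same way in every sample and leaves [w] alone. *)
  pose p (x : K) := if x is inl x' then inl (x'.1, s x'.2) else x.
  apply: (alpha_conj (s := fun=> false) (p := p)).
  + by move=> [[i1 j1]|j1] [[i2 j2]|j2] //= [] -> /perm_inj ->.
  + by move=> x; rewrite -row_permE; apply/matrixP => l j; rewrite !mxE.
  + by [].
  + by rewrite tr_perm_mx -perm_mxM mulgV perm_mx1.
Qed.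

(** Represents [N -> \tr (whiten c N)] in the trace pairing: the covariance [L L^T] for [A], the
    identity for [B]. *)
Definition weight (c : bool) : 'M[R]_d := if c then L *m L^T else 1%:M.

(** The direction [delta_mx j l] has whitened trace [weight c l j]. Each block of the gradient is
    thus a fixed matrix times one number, a multiple of the derivative along that block's scalar. *)
Lemma partial_scalar_point c i j l :
  partial (c, i, (j, l)) ploss a0 = weight c l j * (alpha c i 1%:M / d%:R).
Proof.
transitivity (alpha c i (whiten c (delta_mx j l))).
  rewrite /alpha whitenK /dloss (bigD1 (c, i, (j, l)))//= big1 ?addr0.
    by rewrite /dir /pvec /= eqxx mxE !eqxx mul1r.
  move=> [[c' i'] [j' l']] ne; rewrite /dir /pvec /=.
  case: eqP => [e|_]; last by rewrite mxE mul0r.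
  rewrite mxE; case: eqP => [ej|_]; last by rewrite mul0r.
  case: eqP => [el|_]; last by rewrite mul0r.
  by move: ne; rewrite e ej el eqxx.
rewrite alpha_trace; congr (_ * _); rewrite /whiten /weight; case: c.
  by rewrite -mulmxA mxtrace_mulC -mulmxA mxtrace_delta_mul.
rewrite -mulmxA mxtrace_mulC -mulmxA mulmxV// mulmx1 -[delta_mx _ _]mulmx1.
by rewrite mxtrace_delta_mul.
Qed.

End AtScalarPoint.

End Gradient.

(** * The gradient norm at scalar points *)

Section GradientNorm.
Context {R : realType} {d n k : nat} {dT : measure_display} {T : measurableType dT}
  (P : probability T R).
Context (g : ('I_(n + 1) * 'I_d + 'I_d)%type -> T -> R) (hg : iid_std_normal P g).
Context (L Lw : 'M[R]_d) (Lu : L \in unitmx)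
  (LwE : Lw *m Lw^T = (invmx L)^T *m invmx L) (l0 : 'I_d).

Local Notation f := (@gloss R d n k dT T P g L Lw).
Local Notation F := (@ploss R d n k dT T P g L Lw).

Lemma gradA_partial (a : param -> R) i j l :
  gradA f (pmat a true) (pmat a false) i j l = partial (true, i, (j, l)) F a.
Proof.
rewrite mxE; congr (derive1 _ 0); apply/funext => t; rewrite /ploss.
congr gloss; apply/funext => i'; apply/matrixP => p q; rewrite /upd ?mxE.
  have [->|ne] := eqVneq i' i; first by rewrite !mxE !xpair_eqE !eqxx.
  by rewrite !mxE !xpair_eqE (negbTE ne) andbF mulr0 addr0.
by rewrite !xpair_eqE /= mulr0 addr0.
Qed.

Lemma gradB_partial (a : param -> R) i j l :
  gradB f (pmat a true) (pmat a false) i j l = partial (false, i, (j, l)) F a.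
Proof.
rewrite mxE; congr (derive1 _ 0); apply/funext => t; rewrite /ploss.
congr gloss; apply/funext => i'; apply/matrixP => p q; rewrite /upd ?mxE.
  by rewrite !xpair_eqE /= mulr0 addr0.
have [->|ne] := eqVneq i' i; first by rewrite !mxE !xpair_eqE !eqxx.
by rewrite !mxE !xpair_eqE (negbTE ne) andbF mulr0 addr0.
Qed.

(** The loss restricted to scalar points is a nonnegative polynomial [h] in the scalars. Varying the
    scalar of block [(c, i)] moves the point along the dewhitened identity, so the partial
    derivatives of [h] are the values of [alpha] at [1]. *)
Lemma scalar_critical (eps : R) : 0 < eps -> exists y : bool -> 'I_k.+1 -> R,
  \sum_x alpha P g L Lw y x.1 x.2 1%:M ^+ 2 <= eps.
Proof.
move=> eps0.
pose h (z : bool * 'I_k.+1 -> R) := F (scalar_point L (fun c i => z (c, i))).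
have ph : polyfn h.
  apply: (polyfn_subst (polyfn_ploss hg L Lw)) => -[[c i] [p q]].
  rewrite (_ : (fun z => _) = (fun z => z (c, i) * dewhiten L c 1%:M p q)).
    by apply: polyfnM; [exact: polyfn_var|exact: polyfn_cst].
  apply/funext => z; rewrite /scalar_point /pvec /=.
  by rewrite /dewhiten; case: c; rewrite -(scalemx1 _ (z _)) -scalemxAr -scalemxAl mxE.
have h0 z : 0 <= h z by exact: gloss_ge0.
have [z hz] := polyfn_almost_critical ph h0 eps0.
exists (fun c i => z (c, i)); move: hz; congr (_ <= _); apply: eq_bigr => -[c i] _.
congr (_ ^+ 2); rewrite /alpha.
rewrite -(dloss_val hg L Lw (scalar_point L (fun c' i' => z (c', i')))
  (dir c i (dewhiten L c 1%:M))).
congr (derive1 _ 0).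
apply/funext => t; rewrite /h; congr F; apply/funext => -[[c' i'] [p q]].
rewrite /scalar_point /dir /pvec /=.
have -> : (z (c', i') + t * ((c', i') == (c, i))%:R)%:M =
    (t * ((c', i') == (c, i))%:R) *: 1%:M + (z (c', i'))%:M :> 'M[R]_d.
  by rewrite scalemx1 addrC raddfD.
rewrite dewhiten_linear mxE [X in X + _ = _]mxE addrC; congr (_ + _).
case: eqP => [[-> _]|_]; first by rewrite mulr1.
by rewrite mxE !mulr0 mul0r.
Qed.

Definition weight_norm2 (c : bool) : R := \sum_j \sum_l weight L c l j ^+ 2.

Lemma grad_norm2_scalar_point (y : bool -> 'I_k.+1 -> R) :
  let A := pmat (scalar_point L y) true in let B := pmat (scalar_point L y) false in
  \sum_i (frob2 (gradA f A B i) + frob2 (gradB f A B i)) =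
  \sum_x weight_norm2 x.1 * (alpha P g L Lw y x.1 x.2 1%:M / d%:R) ^+ 2.
Proof.
move=> A B.
rewrite -(pair_big xpredT xpredT
  (fun c i => weight_norm2 c * (alpha P g L Lw y c i 1%:M / d%:R) ^+ 2)) /=.
rewrite big_bool /= -big_split; apply: eq_bigr => i _; congr (_ + _).
  rewrite /weight_norm2 /frob2 mulr_suml; apply: eq_bigr => j _.
  rewrite mulr_suml; apply: eq_bigr => l _.
  by rewrite gradA_partial partial_scalar_point// exprMn.
rewrite /weight_norm2 /frob2 mulr_suml; apply: eq_bigr => j _.
rewrite mulr_suml; apply: eq_bigr => l _.
by rewrite gradB_partial partial_scalar_point// exprMn.
Qed.

End GradientNorm.

Theorem theorem4 (R : realType) (d n k : nat) (hd : (0 < d)%N) (hn : (0 < n)%N)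
  (Sigma : 'M[R]_d) (hSigma : posdef Sigma)
  (L Lw : 'M[R]_d) (hL : L *m L^T = Sigma) (hLw : Lw *m Lw^T = invmx Sigma)
  (dT : measure_display) (T : measurableType dT) (P : probability T R)
  (g : ('I_(n + 1) * 'I_d + 'I_d)%type -> T -> R) (hg : iid_std_normal P g) :
  (* x^(i) = L g_i ~ N(0, Sigma) i.i.d. (columns of X); w_star = Lw h ~ N(0, Sigma^-1) *)
  let X : T -> 'M[R]_(d, n + 1) :=
    fun t => L *m \matrix_(l < d, i < n + 1) g (inl (i, l)) t in
  let w : T -> 'cV[R]_d := fun t => Lw *m \col_(l < d) g (inr l) t in
  let f := @lt_loss _ _ _ P d n k X w in
  inf [set r | exists A B : 'I_k.+1 -> 'M[R]_d,
          (forall i, exists a b : R, A i = a *: invmx Sigma /\ B i = b%:M) /\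
          r = \sum_(i < k.+1) (frob2 (gradA f A B i) + frob2 (gradB f A B i))]
  = 0.
Proof.
move=> X w; rewrite -[lt_loss P X w]/(gloss P g L Lw) => f; set S := [set r | _].
have Su := posdef_unitmx hSigma.
have Lu : L \in unitmx by move: Su; rewrite -hL unitmx_mul => /andP[].
have invS : invmx Sigma = (invmx L)^T *m invmx L.
  have e : (invmx L)^T *m invmx L *m Sigma = 1%:M.
    by rewrite -hL !mulmxA mulmxKV// -trmx_mul mulmxV// trmx1.
  by rewrite -[LHS]mul1mx -e mulmxK.
have LwE : Lw *m Lw^T = (invmx L)^T *m invmx L by rewrite hLw.
pose l0 := Ordinal hd.
have frob2_ge0 (M : 'M[R]_d) : 0 <= frob2 M.
  by apply: sumr_ge0 => j _; apply: sumr_ge0 => l _; rewrite sqr_ge0.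
have S0 : lbound S 0.
  by move=> _ [A [B [_ ->]]]; apply: sumr_ge0 => i _; rewrite addr_ge0.
(* A common bound for both weights; the added 1 makes it positive, so that [eps / C] is a legitimate
   tolerance. *)
pose C := 1 + (weight_norm2 L true + weight_norm2 L false).
have W0 c : 0 <= weight_norm2 L c.
  by apply: sumr_ge0 => j _; apply: sumr_ge0 => l _; rewrite sqr_ge0.
have CW c : weight_norm2 L c <= C.
  by have := W0 true; have := W0 false; rewrite /C; case: c; lra.
have C0 : 0 < C by have := W0 true; have := W0 false; rewrite /C; lra.
have small eps : 0 < eps -> exists2 r, S r & r <= eps.
  move=> eps0; have [y hy] := scalar_critical hg L Lw (divr_gt0 eps0 C0) (k := k).
  pose A := pmat (scalar_point L y) true; pose B := pmat (scalar_point L y) false.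
  exists (\sum_(i < k.+1) (frob2 (gradA f A B i) + frob2 (gradB f A B i))).
    exists A, B; split=> // i; exists (y true i), (y false i).
    rewrite /A /B !pmatK invS /dewhiten; split.
      by rewrite mul_mx_scalar -scalemxAl.
    by rewrite mul_mx_scalar -scalemxAl mulmxV// scalemx1.
  rewrite grad_norm2_scalar_point//.
  (* The weights are bounded by [C], and the factor [1 / d] by one since [d >= 1]. *)
  apply: (@le_trans _ _ (\sum_x C * alpha P g L Lw y x.1 x.2 1%:M ^+ 2)).
    apply: ler_sum => x _; apply: ler_pM; rewrite ?sqr_ge0//.
    rewrite exprMn ler_piMr ?sqr_ge0// exprVn invf_le1 ?exprn_gt0 ?ltr0n//.
    by rewrite exprn_ege1// ler1n.
  by rewrite -mulr_sumr -ler_pdivlMl// mulrC.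
apply/eqP; rewrite eq_le; apply/andP; split.
  apply/ler_addgt0Pr => eps eps0; rewrite add0r.
  have [r Sr reps] := small eps eps0.
  by apply: le_trans reps; apply: ge_inf => //; exists 0.
(* Nonemptiness must be supplied, as [inf] takes a default value on the empty set. *)
apply: lb_le_inf => //.
by have [r Sr _] := small 1 ltr01; exists r.
Qed.
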